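(* Let $G$ be a connected graph. Then $pd_s(G)=2$ if and only if $G$ is a path.
   Context: Graphs are finite, simple, connected (with at least two vertices so that partitions into two nonempty sets exist); $d_G$ is shortest-path distance, $d_G(x,W)=\min\{d_G(x,w):w\in W\}$. A set $W$ strongly resolves different vertices $x,y\notin W$ if $d_G(x,W)=d_G(x,y)+d_G(y,W)$ or $d_G(y,W)=d_G(y,x)+d_G(x,W)$. A vertex partition $\Pi$ is a strong resolving partition if every two different vertices in the same set of $\Pi$ are strongly resolved by some set of $\Pi$; the strong partition dimension $pd_s(G)$ is the minimum cardinality of such a partition (always at least $2$). *)

(* Defs.v *)
From mathcomp Require Import all_boot.

Set Implicit Arguments.
Unset Strict Implicit.
Unset Printing Implicit Defensive.

(* A finite simple graph is an adjacency relation e : rel T on a finType T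
   satisfying simple_graph; the notions below are defined for any such e. *)

Definition simple_graph (T : finType) (e : rel T) : Prop :=
  symmetric e /\ irreflexive e.

Definition connected_graph (T : finType) (e : rel T) : Prop :=
  forall x y : T, connect e x y.

Definition walk (T : finType) (e : rel T) (n : nat) (x y : T) : bool :=
  [exists p : n.-tuple T, path e x p && (last x p == y)].

(* Least length of a walk from x to y. A shortest walk has fewer than #|T|
   edges, so a search among the lengths 0, ..., #|T|.-1 suffices; the value
   #|T| is returned only when y cannot be reached from x. *)
Definition gdist (T : finType) (e : rel T) (x y : T) : nat :=
  find (fun n => walk e n x y) (iota 0 #|T|).

(* The default value #|T| bounds every distance, so this is the true minimum
   whenever W is nonempty. *)
Definition gdist_set (T : finType) (e : rel T) (x : T) (W : {set T}) : nat :=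
  \big[minn/#|T|]_(w in W) gdist e x w.

Definition strongly_resolves (T : finType) (e : rel T) (W : {set T})
    (x y : T) : bool :=
  [&& x != y, x \notin W, y \notin W &
      (gdist_set e x W == gdist e x y + gdist_set e y W)
      || (gdist_set e y W == gdist e y x + gdist_set e x W)].

(* The blocks of a MathComp partition are nonempty, so gdist_set is only
   evaluated at nonempty sets here. *)
Definition strong_resolving_partition (T : finType) (e : rel T)
    (P : {set {set T}}) : bool :=
  partition P [set: T] &&
  [forall U in P, forall x in U, forall y in U,
     (x != y) ==> [exists W in P, strongly_resolves e W x y]].

(* The default value #|T| is harmless: it is attained, since the partition
   into singletons is (vacuously) strong resolving. *)
Definition strong_partition_dim (T : finType) (e : rel T) : nat :=
  \big[minn/#|T|]_(P : {set {set T}} | strong_resolving_partition e P) #|P|.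

Definition path_adj (n : nat) : rel 'I_n :=
  fun i j => (i.+1 == j :> nat) || (j.+1 == i :> nat).

Definition is_path_graph (T : finType) (e : rel T) : Prop :=
  exists (n : nat) (f : T -> 'I_n),
    bijective f /\ forall x y : T, e x y = path_adj (f x) (f y).

(* Main.v *)
(* Let {A, B} be a strong resolving partition. Two vertices x, y of A can only
   be resolved by B, so |d(x,B) - d(y,B)| = d(x,y): on A the map d(-,B) is
   injective and turns adjacency into "differ by one", and likewise d(-,A) on B.
   Edges between the blocks join vertices at distance 1 from the other block,
   and there is one such vertex in each block. Counting d(-,B) downwards on A
   and then d(-,A) upwards on B thus labels the vertices by distinct numbers so
   that edges join consecutive labels. Conversely, an end point of a path
   resolves all the other vertices, and a single block resolves nothing. *)
Require Import Defs.
From mathcomp Require Import all_boot.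
From mathcomp Require Import all_order zify.

(** * Distances between vertices *)

Lemma gdist_le_card {T : finType} (e : rel T) (x y : T) : gdist e x y <= #|T|.
Proof. by rewrite -[leqRHS](size_iota 0) find_size. Qed.

Lemma gdist_le_path {T : finType} {e : rel T} {x : T} {p : seq T} :
  path e x p -> gdist e x (last x p) <= size p.
Proof.
(* A walk with at least [#|T|] edges is covered by the default bound; a shorter one has its length
   in the range of the search. *)
move=> ep; have [szp|szp] := leqP #|T| (size p).
  exact: leq_trans (gdist_le_card e _ _) szp.
rewrite leqNgt; apply/negP => /(before_find 0).
rewrite nth_iota // add0n => /negbT/negP; apply.
by apply/existsP; exists (in_tuple p); rewrite /= ep /=.
Qed.

(** Cutting the cycles out of a walk leaves fewer than [#|T|] edges, so the search in [gdist]
    succeeds whenever [y] is reachable. *)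
Lemma gdist_path {T : finType} {e : rel T} {x y : T} :
  connect e x y ->
  exists p, [/\ path e x p, last x p = y & size p = gdist e x y].
Proof.
case/connectP=> q eq ->; case/shortenP: eq => p ep up _.
have szp : size p < #|T| by have := max_card (mem (x :: p)); rewrite (card_uniqP up).
have hasw : has (fun n => walk e n x (last x p)) (iota 0 #|T|).
  apply/hasP; exists (size p); first by rewrite mem_iota.
  by apply/existsP; exists (in_tuple p); rewrite /= ep /=.
have := nth_find 0 hasw; rewrite nth_iota; last first.
  by rewrite -[ltnRHS](size_iota 0) -has_find.
case/existsP=> r /andP[er /eqP lr].
by exists r; split=> //; rewrite size_tuple.
Qed.

Lemma gdist_eq0 {T : finType} {e : rel T} {x y : T} :
  connect e x y -> (gdist e x y == 0) = (x == y).
Proof.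
case/gdist_path=> p [ep lp szp]; apply/eqP/eqP => [d0|<-].
  by move: szp lp; rewrite d0 => /size0nil ->.
by apply/eqP; rewrite -leqn0 (@gdist_le_path _ _ _ [::]).
Qed.

Lemma gdist_eq1 {T : finType} {e : rel T} {x y : T} :
  irreflexive e -> connect e x y -> (gdist e x y == 1) = e x y.
Proof.
move=> irr cxy; apply/eqP/idP => [d1|exy].
  have [[|z [|? ?]] [ep lp]] := gdist_path cxy; rewrite d1 //.
  by move: ep; rewrite /= andbT -lp.
apply/eqP; rewrite eqn_leq (@gdist_le_path _ _ _ [:: y]) /= ?exy //.
by rewrite lt0n gdist_eq0 //; apply: contraTneq exy => ->; rewrite irr.
Qed.

(** * Distances to a set *)

Lemma gdist_set_le {T : finType} (e : rel T) (x : T) {w : T} {W : {set T}} :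
  w \in W -> gdist_set e x W <= gdist e x w.
Proof.
by move=> wW; rewrite /gdist_set -minEnat -leEnat Order.TotalTheory.bigmin_le_cond.
Qed.

Lemma gdist_set_le_card {T : finType} (e : rel T) (x : T) (W : {set T}) :
  gdist_set e x W <= #|T|.
Proof. by rewrite /gdist_set -minEnat -leEnat Order.TotalTheory.bigmin_le_id. Qed.

Lemma gdist_set_attained {T : finType} (e : rel T) (x : T) {W : {set T}} :
  W != set0 -> exists2 w, w \in W & gdist_set e x W = gdist e x w.
Proof.
case/set0Pn=> w0 w0W; rewrite /gdist_set -minEnat.
have [|w] := @Order.TotalTheory.eq_bigmin _ _ _ #|T| w0 (mem W) (gdist e x) w0W.
  by move=> w _; exact: gdist_le_card.
by exists w.
Qed.

Lemma gdist_set1 {T : finType} (e : rel T) (x w : T) :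
  gdist_set e x [set w] = gdist e x w.
Proof.
have [|v /set1P-> //] := @gdist_set_attained _ e x [set w].
by apply/set0Pn; exists w; rewrite set11.
Qed.

Lemma gdist_set_gt0 {T : finType} {e : rel T} {x : T} {W : {set T}} :
  connected_graph e -> W != set0 -> x \notin W -> 0 < gdist_set e x W.
Proof.
move=> conn W0 xW; have [w wW ->] := gdist_set_attained e x W0.
by rewrite lt0n gdist_eq0 //; apply: contraNneq xW => ->.
Qed.

Lemma gdist_set_eq1 {T : finType} {e : rel T} {x : T} {W : {set T}} :
  irreflexive e -> connected_graph e -> W != set0 -> x \notin W ->
  (gdist_set e x W == 1) = [exists w in W, e x w].
Proof.
move=> irr conn W0 xW; apply/idP/existsP => [|[w /andP[wW exw]]].
  have [w wW ->] := gdist_set_attained e x W0.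
  by rewrite gdist_eq1 // => exw; exists w; rewrite wW.
rewrite eqn_leq gdist_set_gt0 // andbT.
by apply: leq_trans (gdist_set_le e x wW) _; rewrite leq_eqVlt gdist_eq1 ?exw.
Qed.

(** * Strong resolving partitions and their least size *)

Lemma strong_resolving_singletons {T : finType} (e : rel T) :
  strong_resolving_partition e [set [set x] | x : T].
Proof.
apply/andP; split.
  apply/and3P; split.
  - apply/eqP/setP=> x; rewrite inE; apply/bigcupP.
    by exists [set x]; rewrite ?set11 ?imset_f.
  - apply/trivIsetP=> _ _ /imsetP[x _ ->] /imsetP[y _ ->] xy.
    by rewrite disjoints1 inE; apply: contraNneq xy => ->.
  - by apply/imsetP=> -[x _ /setP/(_ x)]; rewrite !inE eqxx.
apply/forall_inP=> _ /imsetP[z _ ->].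
apply/forall_inP=> x /set1P->; apply/forall_inP=> y /set1P->.
by rewrite eqxx.
Qed.

Lemma strong_partition_dim_attained {T : finType} (e : rel T) :
  exists2 P, strong_resolving_partition e P & #|P| = strong_partition_dim e.
Proof.
(* The first case is the default value [#|T|] of the minimum, realised by the singletons. *)
apply: (big_ind (fun m => exists2 P, strong_resolving_partition e P & #|P| = m)).
- exists [set [set x] | x : T]; first exact: strong_resolving_singletons.
  by rewrite card_imset //; exact: set1_inj.
- by move=> m n Pm Pn; rewrite /minn; case: ifP.
- by move=> P rP; exists P.
Qed.

Lemma strong_partition_dim_le {T : finType} {e : rel T} {P : {set {set T}}} :
  strong_resolving_partition e P -> strong_partition_dim e <= #|P|.
Proof.
move=> rP; rewrite /strong_partition_dim -minEnat -leEnat.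
exact: Order.TotalTheory.bigmin_le_cond.
Qed.

(** Two vertices either lie in different blocks, or share a block and are resolved by a set avoiding
    both, which is then a second block. *)
Lemma strong_resolving_partition_gt1 {T : finType} {e : rel T}
    {P : {set {set T}}} :
  1 < #|T| -> strong_resolving_partition e P -> 1 < #|P|.
Proof.
move=> /card_gt1P[x [y [_ _ xy]]] /andP[partP resP].
have covP : cover P = setT by rewrite (cover_partition partP).
have xP : pblock P x \in P by rewrite pblock_mem ?covP.
have xx : x \in pblock P x by rewrite mem_pblock covP.
have [yx|yx] := boolP (y \in pblock P x).
  move/forall_inP: resP => /(_ _ xP)/forall_inP/(_ _ xx)/forall_inP/(_ _ yx).
  rewrite xy => /exists_inP[W WP /and4P[_ xW _ _]].
  by apply/card_gt1P; exists (pblock P x), W; split=> //; apply: contraNneq xW => <-.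
apply/card_gt1P; exists (pblock P x), (pblock P y).
rewrite !pblock_mem ?covP //; split=> //.
by apply: contraNneq yx => ->; rewrite mem_pblock covP.
Qed.

(** * Adjacency in terms of distances to the other block *)

Lemma same_block_gdist {T : finType} {e : rel T} {A B : {set T}} {x y : T} :
  strong_resolving_partition e [set A; B] -> x \in A -> y \in A -> x != y ->
  gdist_set e x B = gdist e x y + gdist_set e y B \/
  gdist_set e y B = gdist e y x + gdist_set e x B.
Proof.
move=> /andP[_ /forall_inP/(_ A)] + xA yA xy.
rewrite set21 => /(_ isT)/forall_inP/(_ _ xA)/forall_inP/(_ _ yA).
rewrite xy => /exists_inP[W] /set2P[]-> /and4P[_ xW _ /orP]; first by rewrite xA in xW.
by case=> /eqP; [left|right].
Qed.

Lemma gdist_set_inj {T : finType} {e : rel T} {A B : {set T}} :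
  connected_graph e -> strong_resolving_partition e [set A; B] ->
  {in A &, injective (fun x => gdist_set e x B)}.
Proof.
move=> conn res x y xA yA axy; apply/eqP/contraT => xy.
have dxy : 0 < gdist e x y by rewrite lt0n gdist_eq0.
have dyx : 0 < gdist e y x by rewrite lt0n gdist_eq0 // eq_sym.
by have := same_block_gdist res xA yA xy; lia.
Qed.

Lemma same_block_adj {T : finType} {e : rel T} {A B : {set T}} {x y : T} :
  simple_graph e -> connected_graph e ->
  strong_resolving_partition e [set A; B] -> x \in A -> y \in A ->
  e x y = ((gdist_set e x B).+1 == gdist_set e y B)
          || ((gdist_set e y B).+1 == gdist_set e x B).
Proof.
move=> [sym irr] conn res xA yA.
have [->|xy] := eqVneq x y; first by rewrite irr; lia.
have dxy : 0 < gdist e x y by rewrite lt0n gdist_eq0.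
(* The two alternatives of resolution use opposite directions of the distance, so both are compared
   with adjacency. *)
have := gdist_eq1 irr (conn x y); have := gdist_eq1 irr (conn y x).
have dyx : 0 < gdist e y x by rewrite lt0n gdist_eq0 // eq_sym.
rewrite (sym y x); have := same_block_gdist res xA yA xy.
by case: (e x y); lia.
Qed.

(** For the converse implication, a vertex [x] at distance 1 from [B] has a neighbour [z] in [B].
    Both [z] and [y] are at distance 1 from [A], and injectivity of that distance on [B] forces
    [z = y]. *)
Lemma cross_block_adj {T : finType} {e : rel T} {A B : {set T}} {x y : T} :
  simple_graph e -> connected_graph e ->
  strong_resolving_partition e [set A; B] -> A = ~: B -> x \in A -> y \in B ->
  e x y = (gdist_set e x B == 1) && (gdist_set e y A == 1).
Proof.
move=> [sym irr] conn res AB xA yB.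
have xB : x \notin B by move: xA; rewrite AB inE.
have yA : y \notin A by rewrite AB inE negbK.
have A0 : A != set0 by apply/set0Pn; exists x.
have B0 : B != set0 by apply/set0Pn; exists y.
apply/idP/andP => [exy|[ax by1]].
  rewrite !gdist_set_eq1 //; split; apply/exists_inP; first by exists y.
  by exists x => //; rewrite sym.
have : gdist_set e x B == 1 by [].
rewrite gdist_set_eq1 // => /exists_inP[z zB exz].
have zA : z \notin A by rewrite AB inE negbK.
have bz : gdist_set e z A == 1.
  by rewrite gdist_set_eq1 //; apply/exists_inP; exists x; rewrite // sym.
rewrite setUC in res.
by rewrite (gdist_set_inj conn res _ _ yB zB) // (eqP by1) (eqP bz).
Qed.

(* Connectedness forces the image of g to be an interval, so ranking the
   vertices by g preserves adjacency. *)
Lemma path_graph_of_labelling {T : finType} {e : rel T} {g : T -> nat} :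
  connected_graph e -> injective g ->
  (forall x y, e x y = ((g x).+1 == g y) || ((g y).+1 == g x)) ->
  is_path_graph e.
Proof.
move=> conn ginj eg.
pose r x := #|[set y | g y < g x]|.
have ltr x y : g x < g y -> r x < r y.
  move=> gxy; apply: proper_card; apply/properP; split.
    by apply/subsetP=> z; rewrite !inE => /ltn_trans; exact.
  by exists x; rewrite !inE ?ltnn.
have rlt x : r x < #|T|.
  rewrite -cardsT; apply: proper_card; apply/properP; split=> //.
  by exists x; rewrite !inE ?ltnn.
have rinj : injective r.
  by move=> x y rxy; apply: ginj; have := ltr x y; have := ltr y x; lia.
have succ x y : ((r x).+1 == r y) = ((g x).+1 == g y).
  apply/eqP/eqP => [rxy|gxy].
    have gxy : g x < g y.
      have [//|gyx|/ginj xy] := ltngtP (g x) (g y).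
        by have := ltr _ _ gyx; lia.
      by rewrite xy in rxy; lia.
    (* Labels change by one along an edge, so a walk from [x] to [y] cannot skip the label just
       above [g x]. *)
    have [z gz] : exists z, g z = (g x).+1.
      have cross p u : path e u p -> g u <= g x -> g x < g (last u p) ->
          exists z, g z = (g x).+1.
        elim: p u => [|z p IHp] u /=; first by lia.
        case/andP; rewrite eg => euz ep gux; have [gz|gz] := leqP (g z) (g x).
          exact: IHp.
        by exists z; lia.
      have /connectP[p ep ly] := conn x y.
      by apply: cross ep _ _; rewrite -?ly.
    (* If [g z < g y], the rank of [z] would lie strictly between the consecutive ranks of [x] and
       [y]. *)
    have rz : r x < r z by apply: ltr; lia.
    have := ltr z y; have : r z = r y -> z = y by move/rinj.
    have := ltr y z; rewrite -gz => H1 H2 H3.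
    have [|lt|/esym] := ltngtP (g z) (g y); lia.
  (* With [g y = (g x).+1], the vertices labelled below [y] are [x] and those labelled below [x]. *)
  have -> : r y = #|x |: [set z | g z < g x]|.
    apply: eq_card => z; rewrite !inE -gxy ltnS leq_eqVlt.
    by rewrite (inj_eq ginj).
  by rewrite cardsU1 inE ltnn.
exists #|T|, (fun x => Ordinal (rlt x)); split=> [|x y]; last first.
  by rewrite /path_adj /= !succ eg.
apply: inj_card_bij; last by rewrite card_ord.
by move=> x y [] /rinj.
Qed.

Lemma path_graph_of_bipartition {T : finType} {e : rel T} {A B : {set T}} :
  simple_graph e -> connected_graph e ->
  strong_resolving_partition e [set A; B] -> A != B -> is_path_graph e.
Proof.
move=> simp conn res AB.
have /andP[/and3P[/eqP cov tri s0] _] := res.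
have A0 : A != set0 by apply: contraNneq s0 => <-; rewrite set21.
have B0 : B != set0 by apply: contraNneq s0 => <-; rewrite set22.
have dAB : [disjoint A & B] by apply: (trivIsetP tri); rewrite ?set21 ?set22.
have AE : A = ~: B.
  apply/setP=> x; rewrite inE; apply/idP/idP => [xA|xB].
    by rewrite (disjointFr dAB xA).
  have /bigcupP[W] : x \in cover [set A; B] by rewrite cov inE.
  by case/set2P=> -> // xB'; rewrite xB' in xB.
have BE : B = ~: A by rewrite AE setCK.
have res' : strong_resolving_partition e [set B; A] by rewrite setUC.
have a_gt0 x : x \in A -> 0 < gdist_set e x B.
  by move=> xA; apply: gdist_set_gt0; rewrite // -in_setC -AE.
have b_gt0 x : x \notin A -> 0 < gdist_set e x A by apply: gdist_set_gt0.
(* Distances to the other block are positive and at most [#|T|], so the subtraction does not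
   truncate, labels on [A] stay below [#|T|] and those on [B] start there. Distance 1 gives
   [#|T|.-1] on [A] and [#|T|] on [B], so exactly the edges between blocks join these two labels. *)
pose g x := if x \in A then #|T| - gdist_set e x B
            else #|T|.-1 + gdist_set e x A.
have AB_ne x y : x \in A -> y \notin A -> g x < g y.
  move=> xA yA; rewrite /g xA (negPf yA).
  have := a_gt0 _ xA; have := b_gt0 _ yA; have := gdist_set_le_card e x B; lia.
have cross x y : x \in A -> y \notin A ->
    e x y = ((g x).+1 == g y) || ((g y).+1 == g x).
  move=> xA yA; rewrite (cross_block_adj simp conn res) //; last by rewrite BE inE.
  rewrite /g xA (negPf yA); have := a_gt0 _ xA; have := b_gt0 _ yA.
  by have := gdist_set_le_card e x B; lia.
apply: (@path_graph_of_labelling _ _ g) => // x y.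
  have [xA|xA] := boolP (x \in A); have [yA|yA] := boolP (y \in A).
  - rewrite /g xA yA => gxy; apply: (gdist_set_inj conn res _ _ xA yA).
    by have := gdist_set_le_card e x B; have := gdist_set_le_card e y B; lia.
  - by have := AB_ne _ _ xA yA; lia.
  - by have := AB_ne _ _ yA xA; lia.
  - rewrite /g (negPf xA) (negPf yA) => /addnI.
    by apply: (gdist_set_inj conn res'); rewrite BE inE.
have [xA|xA] := boolP (x \in A); have [yA|yA] := boolP (y \in A).
- rewrite (same_block_adj simp conn res xA yA) /g xA yA.
  by have := gdist_set_le_card e x B; have := gdist_set_le_card e y B; lia.
- exact: cross.
- by rewrite simp.1 cross // orbC.
- rewrite (same_block_adj simp conn res') ?BE ?inE //.
  by rewrite /g (negPf xA) (negPf yA); lia.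
Qed.

(** * Distances and a two-block partition in a path *)

Lemma path_graph_gdist {T : finType} {e : rel T} {n : nat} {f : T -> 'I_n} :
  connected_graph e -> bijective f ->
  (forall x y, e x y = path_adj (f x) (f y)) ->
  forall x y, gdist e x y = (f x - f y) + (f y - f x).
Proof.
(* With truncated subtraction the sum is the absolute difference of the indices. The upper bound
   comes from a walk moving one index towards [y] at each step. *)
move=> conn [h fK hK] ef x y; apply/eqP; rewrite eqn_leq; apply/andP; split.
  suff [p [ep <- <-]] : exists p,
      [/\ path e x p, last x p = y & size p = (f x - f y) + (f y - f x)].
    exact: gdist_le_path.
  move dk: (_ + _) => k; elim: k x dk => [|k IHk] x dk.
    by exists [::]; split=> //=; apply: (can_inj fK); apply: val_inj => /=; lia.
  have zn : (if f x < f y then (f x).+1 else (f x).-1) < n.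
    by have := ltn_ord (f x); have := ltn_ord (f y); case: ifP; lia.
  pose z := h (Ordinal zn); have fz := congr1 val (hK (Ordinal zn)).
  rewrite -/z /= in fz.
  have [|p [ep lp sp]] := IHk z; first by move: fz; case: ifP; lia.
  exists (z :: p); split=> //=; last by rewrite sp.
  by rewrite ep andbT ef /path_adj; move: fz; case: ifP; lia.
have [p [ep <- <-]] := gdist_path (conn x y).
(* Each edge changes the index by one, so no walk is shorter than the index difference. *)
elim: p x ep => [|z p IHp] x /=; first by lia.
by case/andP; rewrite ef /path_adj => exz /IHp; lia.
Qed.

Lemma path_graph_strong_resolving {T : finType} {e : rel T} :
  connected_graph e -> 1 < #|T| -> is_path_graph e ->
  exists2 P, strong_resolving_partition e P & #|P| = 2.
Proof.
move=> conn T1 [n [f [fbij ef]]].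
have dist := path_graph_gdist conn fbij ef.
have n1 : 1 < n by rewrite -[n]card_ord -(bij_eq_card fbij).
have [h fK hK] := fbij.
(* [x0] is the end point that resolves all other vertices; [x1] witnesses that its complement is
   nonempty. *)
pose x0 := h (Ordinal (ltnW n1)); pose x1 := h (Ordinal n1).
have fx0 : f x0 = 0 :> nat by rewrite hK.
have fx1 : f x1 = 1 :> nat by rewrite hK.
have x10 : x1 != x0 by apply: contra_eq_neq fx1 => ->; rewrite fx0.
exists [set [set x0]; ~: [set x0]]; last first.
  rewrite cards2; suff -> : [set x0] != ~: [set x0] by [].
  by apply/eqP=> /setP/(_ x0); rewrite !inE eqxx.
apply/andP; split.
  apply/and3P; split.
  - rewrite /cover big_setU1 ?big_set1 /= ?setUCr // inE.
    by apply/eqP=> /setP/(_ x0); rewrite !inE eqxx.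
  - by apply/trivIsetP=> U V /set2P[]-> /set2P[]->; rewrite ?eqxx // => _;
      rewrite -setI_eq0 ?setICr // setIC setICr.
  - by apply/set2P=> -[/setP/(_ x0)|/setP/(_ x1)]; rewrite !inE ?eqxx ?x10.
apply/forall_inP=> U UP; apply/forall_inP=> x xU; apply/forall_inP=> y yU.
apply/implyP=> xy; apply/exists_inP; exists [set x0]; first exact: set21.
case/set2P: UP => UE; move: xU yU; rewrite UE !inE => xU yU.
  by rewrite (eqP xU) (eqP yU) eqxx in xy.
(* The distance to [x0] is the index itself, so two such distances differ by exactly the distance
   between the vertices. *)
by rewrite /strongly_resolves xy !inE xU yU /= !gdist_set1 !dist fx0; lia.
Qed.

Theorem theorem19 (T : finType) (e : rel T)
  (hsimple : simple_graph e) (hconn : connected_graph e) (hcard : 1 < #|T|) :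
  strong_partition_dim e = 2 <-> is_path_graph e.
Proof.
have [P resP cardP] := strong_partition_dim_attained e.
split=> [dim2|pathe].
  have /cards2P[A [B [AB PE]]] : #|P| == 2 by rewrite cardP dim2.
  by apply: (@path_graph_of_bipartition _ _ A B); rewrite -?PE.
have [Q resQ cardQ] := path_graph_strong_resolving hconn hcard pathe.
apply/eqP; rewrite eqn_leq -{1}cardQ strong_partition_dim_le //.
by rewrite -cardP (strong_resolving_partition_gt1 hcard resP).
Qed.
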